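(* Let $N=\binom{n}{\lfloor n/2\rfloor}$. Every family $\mathcal{G}$ of subsets of $[n]=\{1,\dots,n\}$ such that the sets in $\mathcal{G}$ take at most three different sizes, and such that $\mathcal{G}$ is $Q_2$-free, has at most $2.15121\,N$ members.
   Context: A family $\mathcal{G}$ of subsets of $[n]$, partially ordered by inclusion, is $Q_2$-free if it contains no four distinct sets $a,b,c,d$ with $a\subset b\subset d$ and $a\subset c\subset d$ (i.e. no subposet isomorphic to the 2-dimensional Boolean lattice $Q_2$, with $a<b$, $a<c$, $b<d$, $c<d$; $b,c$ not required to be incomparable in the host beyond what the subposet relation requires). *)

(* Defs.v *)
From mathcomp Require Import all_boot.

Set Implicit Arguments.
Unset Strict Implicit.
Unset Printing Implicit Defensive.

(* The copy of Q_2 is a weak (not necessarily induced) subposet: b and c may be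
   comparable.  Together with distinctness, the inclusions below are strict. *)
Definition Q2_free (n : nat) (G : {set {set 'I_n}}) : Prop :=
  ~ exists a b c d : {set 'I_n},
      [/\ [/\ a \in G, b \in G, c \in G & d \in G],
          uniq [:: a; b; c; d],
          a \subset b /\ b \subset d
        & a \subset c /\ c \subset d].

Definition set_sizes (n : nat) (G : {set {set 'I_n}}) : seq nat :=
  undup [seq #|A| | A : {set 'I_n} in G].

(* Main.v *)
(** Let the three sizes be i < j < k and let x, y, z be the densities of G in these
    layers.  Choose at random disjoint sets R, P1, P2 of sizes i - 1, j - i - 1,
    k - j - 1 and four further points.  The 1-, 2- and 3-subsets W of the four
    points give the sets R + W, R + P1 + W and R + P1 + P2 + W of sizes i, j and k,
    so G induces a diamond-free coloring of the three middle levels of the Boolean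
    lattice on four points, in which the levels have expected densities x, y, z.

    A flag-algebra argument bounds x + y + z: five squares, each the square of a sum
    over the m = min (i + 1, n - k + 1) admissible choices of one more point (or pair
    of points), have nonnegative mean.  Adding them to the objective leaves a function
    of the coloring whose symmetrisation is at most 2.15121 for every one of the 2^14
    colorings, up to the diagonal terms of the squares, which have relative weight
    1/m.  That loss is paid for by the layer sizes: either one of the layers i and k is
    smaller than the middle binomial coefficient by a factor m/(m + 2), or both are by
    m/(m + 1).  The certificate settles m >= 24 when x and z are close; in the other
    cases a single square, which gives x + y + z <= 2.2071 - 0.2071 |x - z| in the
    limit, is enough. *)

Require Import Defs.
From Stdlib Require Import ZArith Reals Lra.
From mathcomp Require Import all_boot all_algebra all_fingroup.
From mathcomp Require Import ssrZ zify.

Set Implicit Arguments.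
Unset Strict Implicit.
Unset Printing Implicit Defensive.

Import GRing.Theory Num.Theory.

Delimit Scope Z_scope with ZZ.
Delimit Scope ring_scope with RR.
Delimit Scope R_scope with R.

Local Open Scope ring_scope.

(** * Averages over permutations *)

Section PermutationAverages.
Variable T : finType.
Implicit Types (s r : {perm T}) (U C : {set T}).

Lemma perm_of_perm_eq (l l' : seq T) : uniq l -> perm_eq l l' ->
  {r : {perm T} | map r l = l' & forall x, x \notin l -> r x = x}.
Proof.
move=> ul pll; have ul' : uniq l' by rewrite -(perm_uniq pll).
have sz : size l = size l' by apply: perm_size.
pose f x := nth x l' (index x l).
have fout x : x \notin l -> f x = x.
  by move=> xl; rewrite /f nth_default // -sz leqNgt index_mem.
have fin x : x \in l -> f x \in l'.
  by move=> xl; apply: mem_nth; rewrite -sz index_mem.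
have injf : injective f.
  move=> x y; case: (boolP (x \in l)) => xl; case: (boolP (y \in l)) => yl.
  - rewrite /f (set_nth_default y) -?sz ?index_mem // => /eqP.
    rewrite nth_uniq -?sz ?index_mem // => /eqP e.
    by rewrite -(nth_index x xl) e (set_nth_default y) ?index_mem // nth_index.
  - by rewrite (fout y yl) => e; move: (fin x xl); rewrite e -(perm_mem pll) (negPf yl).
  - by rewrite (fout x xl) => e; move: (fin y yl); rewrite -e -(perm_mem pll) (negPf xl).
  - by rewrite !fout.
exists (perm injf); last by move=> x xl; rewrite permE fout.
have [l0|[x0 _]] : l = [::] \/ exists x0, x0 \in l.
  by case: (l) => [|x0 l0]; [left|right; exists x0; rewrite mem_head].
  by move: sz; rewrite l0; case: (l').
apply: (@eq_from_nth _ x0); rewrite ?size_map // => i il.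
rewrite (nth_map x0) // permE /f index_uniq //.
by apply: set_nth_default; rewrite -sz.
Qed.

Lemma perm_on_pair C x y x' y' : x \in C -> y \in C -> x != y ->
    x' \in C -> y' \in C -> x' != y' ->
  {r : {perm T} | perm_on C r & r x = x' /\ r y = y'}.
Proof.
move=> xC yC nxy xC' yC' nxy'; pose r1 := tperm x x'.
have r1on : perm_on C r1.
  apply/subsetP=> t; rewrite !inE /r1; apply: contraNT => tC.
  by rewrite tpermD //; apply: contraNneq tC => <-.
have y1C : r1 y \in C by rewrite (perm_closed _ r1on).
exists (r1 * tperm (r1 y) y')%g.
  apply: perm_onM => //; apply/subsetP=> t; rewrite !inE; apply: contraNT => tC.
  by rewrite tpermD //; apply: contraNneq tC => <-.
rewrite !permM; split; last by rewrite tpermL.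
rewrite /r1 tpermL tpermD //; last by rewrite eq_sym.
by rewrite -[X in _ != X](tpermL x x') (inj_eq perm_inj) eq_sym.
Qed.

Lemma perm_on_imset_id C r U : perm_on C r -> C \subset U \/ [disjoint C & U] ->
  r @: U = U.
Proof.
move=> ron CU; apply/eqP; rewrite eqEcard card_imset ?leqnn ?andbT; last exact: perm_inj.
apply/subsetP=> _ /imsetP[x xU ->]; case: (boolP (x \in C)) => xC.
  case: CU => [/subsetP CU|dCU]; first by apply: CU; rewrite (perm_closed _ ron).
  by move/disjointFr: dCU => /(_ x xC); rewrite xU.
by rewrite (out_perm ron xC).
Qed.

Lemma imset_permM r s U : (r * s)%g @: U = s @: (r @: U).
Proof. by rewrite -imset_comp; apply: eq_imset => x; rewrite /= permM. Qed.

Lemma imset_permD1 r U x : r @: (U :\ x) = (r @: U) :\ r x.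
Proof.
apply/setP=> y; rewrite !inE; apply/imsetP/andP=> [[t]|[yx /imsetP[t tU ey]]].
  by rewrite !inE => /andP[tx tU] ->; rewrite (inj_eq perm_inj) imset_f.
by exists t; rewrite // !inE tU andbT; apply: contraNneq yx => <-; rewrite ey.
Qed.

Lemma sum_perm_mull r (F : {perm T} -> Z) :
  \sum_s F (r * s)%g = \sum_s F s.
Proof. by rewrite [RHS](reindex_inj (mulgI r)). Qed.

Lemma card_permT : #|{perm T}| = #|T|`!.
Proof.
rewrite -cardsT -card_perm; apply: eq_card => s; rewrite !inE; apply/esym.
by apply/subsetP=> x; rewrite inE.
Qed.

Lemma sum_perm_imset_mem (G : {set {set T}}) U :
  ((\sum_(s : {perm T}) (s @: U \in G)) * 'C(#|T|, #|U|) =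
     #|T|`! * #|[set A in G | #|A| == #|U|]|)%N.
Proof.
pose f (A : {set T}) := #|[set s : {perm T} | s @: U == A]|.
have fE (A : {set T}) : #|A| = #|U| -> f A = f U.
  move=> cA.
  have [||r rU _] := @perm_of_perm_eq (enum U ++ enum (~: U)) (enum A ++ enum (~: A)).
  - by rewrite cat_uniq !enum_uniq /= andbT; apply/hasPn=> x; rewrite !mem_enum !inE.
  - apply: uniq_perm => [||x]; rewrite ?mem_cat ?mem_enum ?inE ?orbN //;
      by rewrite cat_uniq !enum_uniq /= andbT; apply/hasPn=> x; rewrite !mem_enum !inE.
  have rUA : r @: U = A.
    move/eqP: rU; rewrite map_cat eqseq_cat ?size_map -?cardE // => /andP[/eqP e _].
    apply/setP=> x; rewrite -(mem_enum A) -e.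
    by apply/imsetP/mapP=> [[t tU ->]|[t tU ->]]; exists t => //; rewrite ?mem_enum // -mem_enum.
  rewrite /f -(card_imset [set s : {perm T} | s @: U == U] (@mulIg _ r)).
  congr #|pred_of_set _|; apply/setP=> s; rewrite inE; apply/eqP/imsetP=> [sU|[t]].
    exists (s * r^-1)%g; rewrite ?mulgKV // inE imset_permM sU -rUA -imset_permM mulgV.
    by apply/eqP; rewrite -[RHS]imset_id; apply: eq_imset => x; rewrite perm1.
  by rewrite inE => /eqP tU ->; rewrite imset_permM tU.
have sumf (P : pred {set T}) :
    (\sum_(s : {perm T}) P (s @: U))%N = (f U * #|[set A in P | #|A| == #|U|]|)%N.
  rewrite (partition_big (fun s : {perm T} => s @: U) predT) //=.
  rewrite (bigID (fun A : {set T} => (A \in P) && (#|A| == #|U|))) /= [X in (_ + X)%N]big1 ?addn0.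
    rewrite (eq_bigr (fun=> f U)) => [|A /andP[PA /eqP cA]].
      rewrite sum_nat_const mulnC; congr (_ * _)%N; apply: eq_card => A.
      by rewrite !inE.
    rewrite -(fE A cA) /f -sum1_card; apply: eq_big => [s|s /eqP ->]; rewrite ?inE //.
    by move: PA; rewrite unfold_in => ->.
  move=> A; rewrite negb_and => nA; apply: big1 => s /eqP sU.
  rewrite -sU unfold_in in nA *; case: (P _) nA => //=.
  by rewrite card_imset ?eqxx //; apply: perm_inj.
have := sumf predT; rewrite sum1_card card_permT.
have -> : #|[set A : {set T} in predT | #|A| == #|U|]| = 'C(#|T|, #|U|).
  by rewrite -card_draws; apply: eq_card => A; rewrite !inE.
move=> ->; rewrite (sumf (mem G)) mulnAC; congr (_ * _)%N.
Qed.

End PermutationAverages.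

Lemma mulrn_Zof_nat (x : Z) k : x *+ k = Z.of_nat k * x.
Proof. by elim: k => [|k IH]; rewrite ?mulr0n // mulrS IH; lia. Qed.

(* Expand the sum over [s] of the square of [\sum_i h i s]. *)
Lemma sum_square_ge0 (I W : finType) (h : I -> W -> Z) (D P : Z) :
    (0 < #|I|)%N ->
    (forall i, \sum_s h i s * h i s = D) ->
    (forall i j, i != j -> \sum_s h i s * h j s = P) ->
  0 <= D + P *+ #|I|.-1.
Proof.
move=> I0 hD hP.
have : 0 <= \sum_s (\sum_i h i s) * (\sum_i h i s).
  by apply: sumr_ge0 => s _; rewrite -expr2 sqr_ge0.
have -> : \sum_s (\sum_i h i s) * (\sum_i h i s) = \sum_i \sum_j \sum_s h i s * h j s.
  rewrite exchange_big /=; under [RHS]eq_bigr => j _ do rewrite exchange_big /=.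
  rewrite [RHS]exchange_big /=; apply: eq_bigr => s _.
  rewrite mulr_suml exchange_big /=; apply: eq_bigr => i _.
  by rewrite mulr_sumr.
rewrite (eq_bigr (fun=> D + P *+ #|I|.-1)) => [|i _].
  by rewrite sumr_const pmulrn_lge0.
rewrite (bigD1 i) //= hD; congr (_ + _).
rewrite (eq_bigr (fun=> P)) => [|j ji]; last by rewrite hP // eq_sym.
by rewrite sumr_const; congr (_ *+ _); rewrite cardC1.
Qed.

Lemma sum_square_ge0_le (I W : finType) (h : I -> W -> Z) (D P : Z) m :
    (0 < m <= #|I|)%N ->
    (forall i, \sum_s h i s * h i s = D) ->
    (forall i j, i != j -> \sum_s h i s * h j s = P) ->
  0 <= D + P *+ m.-1.
Proof.
move=> /andP[m0 mI] hD hP.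
have I0 : (0 < #|I|)%N by apply: leq_trans mI.
have D0 : 0 <= D.
  case/card_gt0P: I0 => i _; rewrite -(hD i).
  by apply: sumr_ge0 => s _; rewrite -expr2 sqr_ge0.
have := sum_square_ge0 I0 hD hP; rewrite !mulrn_Zof_nat => H.
by nia.
Qed.

Section EquivariantSquares.
Variable T : finType.
Implicit Types (s r : {perm T}) (C : {set T}).

(* Pairing the points of [C1] and [C2] along a matching of size [m] keeps the
   error term of order 1/m, although the flags depend on two points. *)
Lemma equivariant_square2 C1 C2 (g : {perm T} -> T -> T -> Z) a b u v m :
    (forall r s x t, perm_on C1 r -> g (r * s)%g x t = g s (r x) t) ->
    (forall r s x t, perm_on C2 r -> g (r * s)%g x t = g s x (r t)) ->
    a \in C1 -> b \in C1 -> a != b -> u \in C2 -> v \in C2 -> u != v ->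
    (0 < m)%N -> (m <= #|C1|)%N -> (m <= #|C2|)%N ->
  0 <= \sum_s g s a u * g s a u + (\sum_s g s a u * g s b v) *+ m.-1.
Proof.
move=> g1 g2 aC bC ab uC vC uv m0 m1 m2.
pose x (i : 'I_m) := enum_val (widen_ord m1 i).
pose t (i : 'I_m) := enum_val (widen_ord m2 i).
have xC i : x i \in C1 by apply: enum_valP.
have tC i : t i \in C2 by apply: enum_valP.
have xI i j : i != j -> x i != x j.
  by apply: contraNneq => /enum_val_inj/(congr1 val)/= e; apply/eqP/val_inj.
have tI i j : i != j -> t i != t j.
  by apply: contraNneq => /enum_val_inj/(congr1 val)/= e; apply/eqP/val_inj.
have move2 (x1 x2 t1 t2 : T) : x1 \in C1 -> x2 \in C1 -> x1 != x2 ->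
    t1 \in C2 -> t2 \in C2 -> t1 != t2 -> forall F : Z -> Z -> Z,
    \sum_s F (g s x1 t1) (g s x2 t2) = \sum_s F (g s a u) (g s b v).
  move=> x1C x2C x12 t1C t2C t12 F.
  have [r ron [ra rb]] := perm_on_pair aC bC ab x1C x2C x12.
  have [r' ron' [ru rv]] := perm_on_pair uC vC uv t1C t2C t12.
  rewrite -[RHS](sum_perm_mull r) -[RHS](sum_perm_mull r'); apply: eq_bigr => s _.
  by rewrite !(g1 r) // ra rb !(g2 r') // ru rv.
have move1 (x1 t1 : T) : x1 \in C1 -> t1 \in C2 ->
    \sum_s g s x1 t1 * g s x1 t1 = \sum_s g s a u * g s a u.
  move=> x1C t1C.
  have [x2 x2C x12] : exists2 x2, x2 \in C1 & x1 != x2.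
    by have [->|n] := eqVneq x1 a; [exists b|exists a].
  have [t2 t2C t12] : exists2 t2, t2 \in C2 & t1 != t2.
    by have [->|n] := eqVneq t1 u; [exists v|exists u].
  exact: (move2 _ _ _ _ x1C x2C x12 t1C t2C t12 (fun p _ => p * p)).
apply: (@sum_square_ge0_le _ _ (fun i s => g s (x i) (t i))).
- by rewrite card_ord m0 leqnn.
- by move=> i; apply: move1.
- move=> i j ij.
  exact: (move2 _ _ _ _ (xC i) (xC j) (xI _ _ ij) (tC i) (tC j) (tI _ _ ij) (fun p q => p * q)).
Qed.

Lemma equivariant_square C (g : {perm T} -> T -> Z) u v m :
    (forall r s t, perm_on C r -> g (r * s)%g t = g s (r t)) ->
    u \in C -> v \in C -> u != v -> (0 < m)%N -> (m <= #|C|)%N ->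
  0 <= \sum_s g s u * g s u + (\sum_s g s u * g s v) *+ m.-1.
Proof.
move=> gE uC vC uv m0 mC.
have move2 (t1 t2 : T) : t1 \in C -> t2 \in C -> t1 != t2 -> forall F : Z -> Z -> Z,
    \sum_s F (g s t1) (g s t2) = \sum_s F (g s u) (g s v).
  move=> t1C t2C t12 F; have [r ron [ru rv]] := perm_on_pair uC vC uv t1C t2C t12.
  rewrite -[RHS](sum_perm_mull r); apply: eq_bigr => s _.
  by rewrite !gE // ru rv.
apply: (@sum_square_ge0_le _ _ (fun (i : {t | t \in C}) s => g s (val i))).
- by rewrite card_sig m0.
- case=> t tC /=.
  have [t2 t2C t12] : exists2 t2, t2 \in C & t != t2.
    by have [->|n] := eqVneq t u; [exists v|exists u].
  exact: (move2 _ _ tC t2C t12 (fun p _ => p * p)).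
- move=> [i iC] [j jC] ij.
  exact: (move2 _ _ iC jC ij (fun p q => p * q)).
Qed.

End EquivariantSquares.

(** * The certificate on four points *)

(* A coloring records which members of levels 1, 2 and 3 of the Boolean lattice
   on four points a, b, u, v belong to the family.  The bit [zw] stands for the
   3-set that misses the point w. *)
Record coloring := Coloring {
  xa : bool; xb : bool; xu : bool; xv : bool;
  yab : bool; yau : bool; yav : bool; ybu : bool; ybv : bool; yuv : bool;
  za : bool; zb : bool; zu : bool; zv : bool }.

Definition colX c (i : nat) : bool :=
  match i with 0 => xa c | 1 => xb c | 2 => xu c | _ => xv c end%N.

Definition colY c (i j : nat) : bool :=
  match i, j with
  | 0, 1 | 1, 0 => yab c
  | 0, 2 | 2, 0 => yau c
  | 0, 3 | 3, 0 => yav c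
  | 1, 2 | 2, 1 => ybu c
  | 1, 3 | 3, 1 => ybv c
  | _, _ => yuv c
  end%N.

Definition colZ c (i : nat) : bool :=
  match i with 0 => za c | 1 => zb c | 2 => zu c | _ => zv c end%N.

Definition relabel (o : nat * nat * nat * nat) (c : coloring) : coloring :=
  let: (i, j, k, l) := o in
  Coloring (colX c i) (colX c j) (colX c k) (colX c l)
    (colY c i j) (colY c i k) (colY c i l) (colY c j k) (colY c j l) (colY c k l)
    (colZ c i) (colZ c j) (colZ c k) (colZ c l).

Definition orders : seq (nat * nat * nat * nat) :=
  [:: (0, 1, 2, 3); (0, 1, 3, 2); (0, 2, 1, 3); (0, 2, 3, 1); (0, 3, 1, 2); (0, 3, 2, 1);
      (1, 0, 2, 3); (1, 0, 3, 2); (1, 2, 0, 3); (1, 2, 3, 0); (1, 3, 0, 2); (1, 3, 2, 0);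
      (2, 0, 1, 3); (2, 0, 3, 1); (2, 1, 0, 3); (2, 1, 3, 0); (2, 3, 0, 1); (2, 3, 1, 0);
      (3, 0, 1, 2); (3, 0, 2, 1); (3, 1, 0, 2); (3, 1, 2, 0); (3, 2, 0, 1); (3, 2, 1, 0)]%N.

Definition sum_orders (f : coloring -> Z) (c : coloring) : Z :=
  foldr (fun (o : nat * nat * nat * nat) (acc : Z) => (f (relabel o c) + acc)%ZZ) 0%ZZ orders.

(* The numerical data is a rounded solution of the semidefinite program, scaled
   by 80000; 6400000000 = 80000^2 and 13767744000 = 2.15121 * 80000^2. *)
Definition mid_vec (y x z : bool) : Z :=
  (if y then
     if x then if z then -24005 else 28950
     else if z then 28950 else 11768
   else 0)%ZZ.

Definition pair_vec (r1 r2 r12 x y1 y2 : bool) : Z :=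
  (if r1 then
     if r2 then
       if r12 then
         if x then
           if y1 then if y2 then 11384 else -41196
           else if y2 then -41196 else -9690
         else if y1 then if y2 then 97251 else 0 else 0
       else if y1 then if y2 then 98803 else 13214
            else if y2 then 13214 else -21997
     else if r12 then
       if x then if y1 then 75492 else -24482
       else if y1 then 87487 else 0
     else 0
   else 0)%ZZ.

Definition pair_diff_vec (r1 r2 r12 x y1 y2 : bool) : Z :=
  (if r1 then
     if r2 then
       if r12 then
         if x then
           if y1 then if y2 then 0 else 52580
           else if y2 then -52580 else 0
         else 0
       else if y1 then if y2 then 0 else 35211
            else if y2 then -35211 else 0
     else 0
   else 0)%ZZ.

Definition Zb (b : bool) : Z := if b then 1%ZZ else 0%ZZ.

Definition mid1 c := mid_vec (yab c) (xb c) (zv c).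
Definition mid2 c := mid_vec (yab c) (xa c) (zu c).

Section Flags.
Variable vec : bool -> bool -> bool -> bool -> bool -> bool -> Z.
Definition up1 c := vec (xa c) (xb c) (yab c) (xu c) (yau c) (ybu c).
Definition up2 c := vec (xa c) (xb c) (yab c) (xv c) (yav c) (ybv c).
Definition down1 c := vec (za c) (zb c) (yuv c) (zu c) (ybv c) (yav c).
Definition down2 c := vec (za c) (zb c) (yuv c) (zv c) (ybu c) (yau c).
End Flags.

Definition objective c : Z := (Zb (xa c) + Zb (yab c) + Zb (zv c))%ZZ.
Definition outer c : Z := (Zb (xa c) + Zb (zv c))%ZZ.

Definition cross c : Z :=
  (mid1 c * mid2 c
   + (up1 pair_vec c * up2 pair_vec c + up1 pair_diff_vec c * up2 pair_diff_vec c)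
   + (down1 pair_vec c * down2 pair_vec c
      + down1 pair_diff_vec c * down2 pair_diff_vec c))%ZZ.

Definition diag c : Z :=
  (mid1 c * mid1 c
   + (up1 pair_vec c * up1 pair_vec c + up1 pair_diff_vec c * up1 pair_diff_vec c)
   + (down1 pair_vec c * down1 pair_vec c
      + down1 pair_diff_vec c * down1 pair_diff_vec c))%ZZ.

Definition diamond c : bool := [&& xa c, yab c, yau c & zv c].

(* With x, y, z the mean densities of the levels and S = 80000, the tests say that
   x + y + z + cross / S^2 <= 2.15121 and
   x + y + z + (23 cross + diag) / (24 S^2) <= 2.15121 + (x + z) / 25 - 1/96.
   They are the cases 1/m = 0 and 1/m = 1/24 of a bound that is affine in 1/m, so they
   cover every m >= 24. *)
Definition certified c : bool :=
  if has (fun o => diamond (relabel o c)) orders then true else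
  let ob := sum_orders objective c in
  let p := sum_orders cross c in
  (if ob * 6400000000 + p <=? 24 * 13767744000 then
     600 * 6400000000 * ob + 575 * p + 25 * sum_orders diag c
       - 24 * 6400000000 * sum_orders outer c + 150 * 6400000000
     <=? 14400 * 13767744000
   else false)%ZZ.

Definition all_bool (f : bool -> bool) : bool := if f true then f false else false.

Lemma all_boolP (f : bool -> bool) : all_bool f -> forall b, f b.
Proof. by rewrite /all_bool; case E: (f true) => // E' []. Qed.

Lemma all_certified :
  all_bool (fun a1 => all_bool (fun a2 => all_bool (fun a3 => all_bool (fun a4 =>
  all_bool (fun b1 => all_bool (fun b2 => all_bool (fun b3 =>
  all_bool (fun b4 => all_bool (fun b5 => all_bool (fun b6 =>
  all_bool (fun c1 => all_bool (fun c2 => all_bool (fun c3 => all_bool (fun c4 =>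
    certified (Coloring a1 a2 a3 a4 b1 b2 b3 b4 b5 b6 c1 c2 c3 c4))))))))))))))).
Proof. vm_cast_no_check (erefl true). Qed.

Lemma certifiedP c : certified c.
Proof.
case: c => a1 a2 a3 a4 b1 b2 b3 b4 b5 b6 c1 c2 c3 c4.
have H := all_certified.
move/all_boolP/(_ a1)/all_boolP/(_ a2)/all_boolP/(_ a3)/all_boolP/(_ a4): H.
move/all_boolP/(_ b1)/all_boolP/(_ b2)/all_boolP/(_ b3).
move/all_boolP/(_ b4)/all_boolP/(_ b5)/all_boolP/(_ b6).
by move/all_boolP/(_ c1)/all_boolP/(_ c2)/all_boolP/(_ c3)/all_boolP/(_ c4).
Qed.

(** * Embedding the four-point lattice at random *)

Definition diamond_free (T : finType) (G : {set {set T}}) : Prop :=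
  forall A B B' D : {set T},
  A \in G -> B \in G -> B' \in G -> D \in G ->
  A \proper B -> A \proper B' -> B \proper D -> B' \proper D -> B = B'.

Section Frame.
Variables (T : finType) (G : {set {set T}}) (a b u v : T) (R P1 P2 : {set T}).
Hypothesis uniq4 : uniq [:: a; b; u; v].
Hypothesis disj : forall w, w \in [:: a; b; u; v] -> w \notin R :|: P1 :|: P2.
Hypothesis disjR : [disjoint R & P1 :|: P2].
Hypothesis disjP : [disjoint P1 & P2].
Hypothesis free : diamond_free G.
Implicit Types (s r : {perm T}) (U C : {set T}).

Definition bit s U : bool := s @: U \in G.
Definition low t : {set T} := t |: R.
Definition mid t t' : {set T} := t |: (t' |: (R :|: P1)).
Definition quad : {set T} := [set a; b; u; v] :|: R :|: P1.
Definition top t : {set T} := (quad :|: P2) :\ t.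

Definition coloring_of s : coloring :=
  Coloring (bit s (low a)) (bit s (low b)) (bit s (low u)) (bit s (low v))
    (bit s (mid a b)) (bit s (mid a u)) (bit s (mid a v))
    (bit s (mid b u)) (bit s (mid b v)) (bit s (mid u v))
    (bit s (top a)) (bit s (top b)) (bit s (top u)) (bit s (top v)).

Let neqs : (((a == b) = false) * ((b == a) = false) * ((a == u) = false) *
  ((u == a) = false) * ((a == v) = false) * ((v == a) = false)) *
  (((b == u) = false) * ((u == b) = false) * ((b == v) = false) *
  ((v == b) = false) * ((u == v) = false) * ((v == u) = false)).
Proof.
move: uniq4; rewrite /= !inE !negb_or !andbT => /and3P[/and3P[ab au av] /andP[bu bv] uv].
by do !split; apply/negbTE => //; rewrite eq_sym.
Qed.

Let nin w (h : w \in [:: a; b; u; v]) :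
  ((w \in R) = false) * ((w \in P1) = false) * ((w \in P2) = false).
Proof. by move: (disj h); rewrite !inE !negb_or => /andP[/andP[]]; do !move/negbTE->. Qed.

Let notin : (((a \in R) = false) * ((a \in P1) = false) * ((a \in P2) = false)) *
  (((b \in R) = false) * ((b \in P1) = false) * ((b \in P2) = false)) *
  (((u \in R) = false) * ((u \in P1) = false) * ((u \in P2) = false)) *
  (((v \in R) = false) * ((v \in P1) = false) * ((v \in P2) = false)).
Proof. by do !split; rewrite nin // !inE eqxx ?orbT. Qed.

Definition eqs := (neqs, notin).

Ltac set_eq :=
  apply/setP=> w; rewrite !inE;
  have [->|?] := eqVneq w a; rewrite ?eqs ?eqxx ?orbT ?andbT ?orbF ?andbF //=;
  have [->|?] := eqVneq w b; rewrite ?eqs ?eqxx ?orbT ?andbT ?orbF ?andbF //=;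
  have [->|?] := eqVneq w u; rewrite ?eqs ?eqxx ?orbT ?andbT ?orbF ?andbF //=;
  have [->|?] := eqVneq w v; rewrite ?eqs ?eqxx ?orbT ?andbT ?orbF ?andbF //=.

Lemma midC t t' : mid t t' = mid t' t.
Proof. by rewrite /mid setUCA. Qed.

Lemma quadDab : quad :\ a :\ b = mid u v. Proof. rewrite /quad /mid; set_eq. Qed.
Lemma quadDau : quad :\ a :\ u = mid b v. Proof. rewrite /quad /mid; set_eq. Qed.
Lemma quadDav : quad :\ a :\ v = mid b u. Proof. rewrite /quad /mid; set_eq. Qed.
Lemma quadDbu : quad :\ b :\ u = mid a v. Proof. rewrite /quad /mid; set_eq. Qed.
Lemma quadDbv : quad :\ b :\ v = mid a u. Proof. rewrite /quad /mid; set_eq. Qed.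

Definition outside : {set T} := ~: (quad :|: P2).
Definition ups : {set T} := [set u; v] :|: outside.
Definition downs : {set T} := [set u; v] :|: R.
Definition core : {set T} := [set a; b] :|: R.

Lemma coreDa : core :\ a = low b. Proof. rewrite /core /low; set_eq. Qed.
Lemma coreDb : core :\ b = low a. Proof. rewrite /core /low; set_eq. Qed.
Lemma coreP1 : core :|: P1 = mid a b. Proof. rewrite /core /mid; set_eq. Qed.
Lemma coreUu : u |: (core :|: P1 :|: P2) = top v.
Proof. rewrite /core /top /quad; set_eq. Qed.
Lemma coreUv : v |: (core :|: P1 :|: P2) = top u.
Proof. rewrite /core /top /quad; set_eq. Qed.

Lemma bitM r s U : bit (r * s)%g U = bit s (r @: U).
Proof. by rewrite /bit imset_permM. Qed.

Lemma relabel_coloring_of o : o \in orders ->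
  {r : {perm T} | forall s, relabel o (coloring_of s) = coloring_of (r * s)%g}.
Proof.
pose pt := nth a [:: a; b; u; v].
pose idx (o : nat * nat * nat * nat) := let: (i, j, k, l) := o in [:: i; j; k; l].
have ok : all (fun o => perm_eq (iota 0 4) (idx o)) orders by vm_compute.
move=> oo; have /(perm_map pt) := allP ok o oo.
rewrite [map pt (iota 0 4)]/= => /(perm_of_perm_eq uniq4)[r rl rout].
have rP1 : r @: (R :|: P1) = R :|: P1.
  apply: (@perm_on_imset_id _ [set a; b; u; v]).
    by apply/subsetP=> w; rewrite !inE; apply: contraNT => nw; rewrite rout // !inE !orbA.
  by right; rewrite disjoint_subset; apply/subsetP=> w; rewrite !inE -!orbA
    => /or4P[] /eqP ->; rewrite !eqs.
have rR : r @: R = R.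
  apply: (@perm_on_imset_id _ [set a; b; u; v]).
    by apply/subsetP=> w; rewrite !inE; apply: contraNT => nw; rewrite rout // !inE !orbA.
  by right; rewrite disjoint_subset; apply/subsetP=> w; rewrite !inE -!orbA
    => /or4P[] /eqP ->; rewrite !eqs.
have rQ : r @: (quad :|: P2) = quad :|: P2.
  apply: (@perm_on_imset_id _ [set a; b; u; v]).
    by apply/subsetP=> w; rewrite !inE; apply: contraNT => nw; rewrite rout // !inE !orbA.
  by left; apply/subsetP=> w; rewrite /quad !inE => ->.
have rlow s t : bit (r * s)%g (low t) = bit s (low (r t)).
  by rewrite bitM /low imsetU1 rR.
have rmid s t t' : bit (r * s)%g (mid t t') = bit s (mid (r t) (r t')).
  by rewrite bitM /mid !imsetU1 rP1.
have rtop s t : bit (r * s)%g (top t) = bit s (top (r t)).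
  by rewrite bitM /top imset_permD1 rQ.
exists r => s; rewrite [in RHS]/coloring_of !rlow !rmid !rtop.
have mC := (midC b a, midC u a, midC v a, midC u b, midC v b, midC v u).
move: oo rl; rewrite /orders !inE.
do 23?[case/orP=> [/eqP -> /= [-> -> -> ->]|]; first by rewrite /relabel /= /pt /= ?mC].
by move=> /eqP -> /= [-> -> -> ->]; rewrite /relabel /= /pt /= ?mC.
Qed.

Lemma sum_relabel (f : coloring -> Z) o : o \in orders ->
  \sum_s f (relabel o (coloring_of s)) = \sum_s f (coloring_of s).
Proof.
move=> /relabel_coloring_of[r rE]; under eq_bigr => s _ do rewrite rE.
exact: (sum_perm_mull r (fun s => f (coloring_of s))).
Qed.

Lemma sum_sum_orders (f : coloring -> Z) :
  \sum_s sum_orders f (coloring_of s) = (\sum_s f (coloring_of s)) *+ 24.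
Proof.
rewrite -[24%N]/(size orders) /sum_orders.
have: {subset orders <= orders} by [].
elim: {1 3 4}orders => [|o l IH] sub /=; first by rewrite big1.
rewrite big_split /= sum_relabel ?sub ?mem_head // IH ?mulrS // => x xl.
by rewrite sub // inE xl orbT.
Qed.

Lemma no_diamond s : ~~ diamond (coloring_of s).
Proof.
rewrite /diamond /=; apply/negP=> /and4P[A B B' D].
have inj : injective s by apply: perm_inj.
have pr (U V : {set T}) : U \proper V -> s @: U \proper s @: V.
  rewrite !properEneq => /andP[nUV sUV]; rewrite imsetS // andbT.
  by rewrite (inj_eq (imset_inj inj)).
have e : s @: mid a b = s @: mid a u.
  apply: (free A B B' D); apply: pr.
  - apply/properP; split; last by exists b; rewrite !inE !eqs ?eqxx ?orbT.
    by apply/subsetP=> w; rewrite !inE => /orP[->|->]; rewrite ?orbT.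
  - apply/properP; split; last by exists u; rewrite !inE !eqs ?eqxx ?orbT.
    by apply/subsetP=> w; rewrite !inE => /orP[->|->]; rewrite ?orbT.
  - apply/properP; split; last by exists u; rewrite !inE !eqs ?eqxx ?orbT.
    apply/subsetP=> w; rewrite !inE; have [->|_] := eqVneq w v; rewrite ?eqs //=.
    by move=> /or4P[] ->; rewrite ?orbT.
  - apply/properP; split; last by exists b; rewrite !inE !eqs ?eqxx ?orbT.
    apply/subsetP=> w; rewrite !inE; have [->|_] := eqVneq w v; rewrite ?eqs //=.
    by move=> /or4P[] ->; rewrite ?orbT.
have := imset_inj inj e => /setP/(_ b); by rewrite !inE !eqs ?eqxx.
Qed.

Let u_neq_v : u != v. Proof. by rewrite eqs. Qed.
Let a_neq_b : a != b. Proof. by rewrite eqs. Qed.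

Let disjoint_ups U : U \subset quad :|: P2 -> u \notin U -> v \notin U -> [disjoint ups & U].
Proof.
move=> sU nu nv; rewrite disjoint_subset; apply/subsetP=> w.
rewrite !inE -orbA => /or3P[/eqP ->|/eqP ->|nw] //.
by apply: contra nw => /(subsetP sU); rewrite !inE.
Qed.

Lemma up_square vec m : (0 < m)%N -> (m <= #|ups|)%N ->
  0 <= \sum_s (up1 vec (coloring_of s) * up1 vec (coloring_of s))%ZZ +
       (\sum_s (up1 vec (coloring_of s) * up2 vec (coloring_of s))%ZZ) *+ m.-1.
Proof.
move=> m0 mC.
pose g s t := vec (bit s (low a)) (bit s (low b)) (bit s (mid a b))
  (bit s (low t)) (bit s (mid a t)) (bit s (mid b t)).
apply: (@equivariant_square T ups g u v m) => //; try by rewrite !inE eqxx ?orbT.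
move=> r s t ron.
have ra : r a = a by apply: (out_perm ron); rewrite !inE !eqs eqxx.
have rb : r b = b by apply: (out_perm ron); rewrite !inE !eqs eqxx ?orbT.
have rR : r @: R = R.
  apply: (perm_on_imset_id ron); right; apply: disjoint_ups; rewrite ?eqs //.
  by apply/subsetP=> w; rewrite !inE => ->; rewrite ?orbT.
have rP : r @: (R :|: P1) = R :|: P1.
  apply: (perm_on_imset_id ron); right; apply: disjoint_ups; rewrite ?inE ?eqs //.
  by apply/subsetP=> w; rewrite !inE => /orP[] ->; rewrite ?orbT.
by rewrite /g !bitM /low /mid !imsetU1 ra rb rR rP.
Qed.

Let perm_on_downs_quad r : perm_on downs r -> r @: quad = quad.
Proof.
move=> ron; apply: (perm_on_imset_id ron); left; apply/subsetP=> w.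
by rewrite !inE -!orbA => /or3P[] ->; rewrite ?orbT.
Qed.

Let perm_on_downs_top r : perm_on downs r -> r @: (quad :|: P2) = quad :|: P2.
Proof.
move=> ron; apply: (perm_on_imset_id ron); left; apply/subsetP=> w.
by rewrite !inE -!orbA => /or3P[] ->; rewrite ?orbT.
Qed.

Lemma down_square vec m : (0 < m)%N -> (m <= #|downs|)%N ->
  0 <= \sum_s (down1 vec (coloring_of s) * down1 vec (coloring_of s))%ZZ +
       (\sum_s (down1 vec (coloring_of s) * down2 vec (coloring_of s))%ZZ) *+ m.-1.
Proof.
move=> m0 mC.
pose g s t := vec (bit s (top a)) (bit s (top b)) (bit s (quad :\ a :\ b))
  (bit s (top t)) (bit s (quad :\ a :\ t)) (bit s (quad :\ b :\ t)).
have -> : \sum_s (down1 vec (coloring_of s) * down1 vec (coloring_of s))%ZZ =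
    \sum_s g s u * g s u.
  by apply: eq_bigr => s _; rewrite /g quadDab quadDau quadDbu.
have -> : \sum_s (down1 vec (coloring_of s) * down2 vec (coloring_of s))%ZZ =
    \sum_s g s u * g s v.
  by apply: eq_bigr => s _; rewrite /g quadDab quadDau quadDbu quadDav quadDbv.
apply: (@equivariant_square T downs g u v m) => //; try by rewrite !inE eqxx ?orbT.
move=> r s t ron.
have ra : r a = a by apply: (out_perm ron); rewrite !inE !eqs.
have rb : r b = b by apply: (out_perm ron); rewrite !inE !eqs.
by rewrite /g !bitM /top !imset_permD1 ra rb perm_on_downs_quad // perm_on_downs_top.
Qed.

Lemma mid_square m : (0 < m)%N -> (m <= #|core|)%N -> (m <= #|ups|)%N ->
  0 <= \sum_s (mid1 (coloring_of s) * mid1 (coloring_of s))%ZZ +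
       (\sum_s (mid1 (coloring_of s) * mid2 (coloring_of s))%ZZ) *+ m.-1.
Proof.
move=> m0 m1 m2.
pose g s x t := mid_vec (bit s (core :|: P1)) (bit s (core :\ x))
  (bit s (t |: (core :|: P1 :|: P2))).
have -> : \sum_s (mid1 (coloring_of s) * mid1 (coloring_of s))%ZZ = \sum_s g s a u * g s a u.
  by apply: eq_bigr => s _; rewrite /g coreUu coreP1 coreDa.
have -> : \sum_s (mid1 (coloring_of s) * mid2 (coloring_of s))%ZZ = \sum_s g s a u * g s b v.
  by apply: eq_bigr => s _; rewrite /g coreUu coreUv coreP1 coreDa coreDb.
have sub1 : core \subset core :|: P1 by rewrite subsetUl.
have sub2 : core \subset core :|: P1 :|: P2 by rewrite -setUA subsetUl.
apply: (@equivariant_square2 T core ups g a b u v m) => //;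
  try by rewrite !inE eqxx ?orbT.
- move=> r s x t ron.
  have rE U : core \subset U -> r @: U = U by move=> ?; apply: (perm_on_imset_id ron); left.
  rewrite /g !bitM imset_permD1 !rE //.
  exact: (subset_trans sub2 (subsetUr _ _)).
- move=> r s x t ron.
  have rE U : U \subset core :|: P1 :|: P2 -> r @: U = U.
    move=> sU; apply: (perm_on_imset_id ron); right; apply: disjoint_ups.
    - apply: (subset_trans sU); apply/subsetP=> w.
      by rewrite !inE -!orbA; do 4?[case/orP=> [->|]; rewrite ?orbT //]; move=> ->; rewrite ?orbT.
    - by apply/negP=> /(subsetP sU); rewrite !inE !eqs.
    - by apply/negP=> /(subsetP sU); rewrite !inE !eqs.
  rewrite /g !bitM imsetU1 !rE ?subsetUl //.
  by apply: (subset_trans _ sub2); rewrite subD1set.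
Qed.

Local Notation SX := (\sum_s Zb (xa (coloring_of s)))%RR.
Local Notation SY := (\sum_s Zb (yab (coloring_of s)))%RR.
Local Notation SZ := (\sum_s Zb (zv (coloring_of s)))%RR.
Local Notation N := (Z.of_nat #|{perm T}|).

Let sum_le (f : {perm T} -> Z) (k : Z) : (forall s, f s <= k)%ZZ -> (\sum_s f s <= k * N)%ZZ.
Proof.
move=> fk; have : \sum_s f s <= \sum_(s : {perm T}) k by apply: ler_sum => s _; move: (fk s); lia.
rewrite sumr_const [#|_|](_ : _ = #|{perm T}|) ?mulrn_Zof_nat; last exact: eq_card.
by lia.
Qed.

Let sumD (f g : {perm T} -> Z) : \sum_s (f s + g s)%ZZ = (\sum_s f s + \sum_s g s)%ZZ.
Proof. exact: big_split. Qed.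

Let sumB (f g : {perm T} -> Z) : \sum_s (f s - g s)%ZZ = (\sum_s f s - \sum_s g s)%ZZ.
Proof. exact: sumrB. Qed.

Let sumZ k (f : {perm T} -> Z) : \sum_s (k * f s)%ZZ = (k * \sum_s f s)%ZZ.
Proof. by apply/esym; exact: mulr_sumr. Qed.

Lemma certificate_bound m :
    (24 <= m)%N -> (m <= #|ups|)%N -> (m <= #|core|)%N -> (m <= #|downs|)%N ->
  (Z.of_nat m * (SX + SY + SZ) * 2400000 <=
    Z.of_nat m * N * 5162904 + 24 * 96000 * (SX + SZ) - 600000 * N)%ZZ.
Proof.
move=> m24 mu mc md; have m0 : (0 < m)%N by apply: leq_trans m24.
pose Ob := \sum_s objective (coloring_of s); pose Ou := \sum_s outer (coloring_of s).
pose Cr := \sum_s cross (coloring_of s); pose Di := \sum_s diag (coloring_of s).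
have ObE : Ob = (SX + SY + SZ)%ZZ by rewrite /Ob /objective !sumD.
have OuE : Ou = (SX + SZ)%ZZ by rewrite /Ou /outer !sumD.
have squares : 0 <= Di + Cr *+ m.-1.
  have add5 (d1 d2 d3 d4 d5 p1 p2 p3 p4 p5 : Z) k :
      0 <= d1 + p1 *+ k -> 0 <= d2 + p2 *+ k -> 0 <= d3 + p3 *+ k ->
      0 <= d4 + p4 *+ k -> 0 <= d5 + p5 *+ k ->
      0 <= d1 + (d2 + d3) + (d4 + d5) + (p1 + (p2 + p3) + (p4 + p5)) *+ k.
    by rewrite !mulrn_Zof_nat; lia.
  rewrite /Di /Cr /diag /cross !big_split; apply: add5;
    [exact: mid_square|exact: up_square|exact: up_square|exact: down_square|exact: down_square].
have pw s : let c := coloring_of s in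
    (6400000000 * sum_orders objective c + sum_orders cross c <= 24 * 13767744000 /\
     600 * 6400000000 * sum_orders objective c + 575 * sum_orders cross c
       + 25 * sum_orders diag c - 24 * 6400000000 * sum_orders outer c
     <= 14400 * 13767744000 - 150 * 6400000000)%ZZ.
  move=> c; have := certifiedP c; rewrite /certified ifN.
    by case: Z.leb_spec => // h /Z.leb_le h'; split; lia.
  by apply/hasPn=> o /relabel_coloring_of[r ->]; apply: no_diamond.
have h1 := sum_le (fun s => (pw s).1); have h2 := sum_le (fun s => (pw s).2).
rewrite sumD sumZ !sum_sum_orders -/Ob -/Cr in h1.
rewrite sumB sumD sumD !sumZ !sum_sum_orders -/Ob -/Cr -/Di -/Ou in h2.
rewrite -ObE -OuE; move: h1 h2 squares; rewrite !mulrn_Zof_nat.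
have -> : Z.of_nat m.-1 = (Z.of_nat m - 1)%ZZ by lia.
have k24 : (24 <= Z.of_nat m)%ZZ by lia.
move: (Z.of_nat m) k24 Ob Ou Cr Di N {ObE OuE pw} => k k24 Ob Ou Cr Di M h1 h2 sq.
have h3 : (0 <= (k - 24) * (24 * 13767744000 * M - (6400000000 * (24 * Ob) + 24 * Cr)))%ZZ.
  by apply: Z.mul_nonneg_nonneg; lia.
by lia.
Qed.

(* Uses the square of the sum of [1_{D in G} (1_{B in G} - c)], where [B] runs over the
   middle sets below a fixed top set [D] and [c = (5/6 + 1/m) / 2]. *)
Lemma top_link_bound m : (0 < m)%N -> (m <= #|downs|)%N ->
  let k := Z.of_nat m in
  (120 * k * k * (SX + SY + SZ) <=
    120 * k * k * (N + SX) + 144 * k * (k - 1) * (N - SX) + (5 * k + 6) * (5 * k + 6) * SZ)%ZZ.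
Proof.
move=> m0 mC k.
pose l := (5 * k + 6)%ZZ.
pose vec (r1 r2 r12 x y1 y2 : bool) : Z := (Zb r1 * (12 * k * Zb y1 - l))%ZZ.
have := down_square vec m0 mC; rewrite mulrn_Zof_nat.
pose zy c := (Zb (za c) * Zb (ybu c))%ZZ; pose zyy c := (zy c * Zb (ybv c))%ZZ.
have eqz : \sum_s Zb (za (coloring_of s)) = SZ.
  exact: (@sum_relabel (fun c => Zb (zv c)) (3, 1, 2, 0)%N).
have eqzy : \sum_s (Zb (za (coloring_of s)) * Zb (ybv (coloring_of s)))%ZZ =
    \sum_s zy (coloring_of s).
  exact: (@sum_relabel zy (0, 1, 3, 2)%N).
have e1 c : (down1 vec c * down1 vec c)%ZZ =
    ((144 * k * k - 24 * k * l) * (Zb (za c) * Zb (ybv c)) + l * l * Zb (za c))%ZZ.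
  by rewrite /down1 /vec; case: (za c); case: (ybv c); rewrite /Zb; nia.
have e2 c : (down1 vec c * down2 vec c)%ZZ =
    (144 * k * k * zyy c + (- (12 * k * l)) * (Zb (za c) * Zb (ybv c))
      + (- (12 * k * l)) * zy c + l * l * Zb (za c))%ZZ.
  by rewrite /down1 /down2 /zyy /zy /vec; case: (za c); case: (ybv c); case: (ybu c); rewrite /Zb; nia.
rewrite (eq_bigr _ (fun s _ => e1 (coloring_of s))) (eq_bigr _ (fun s _ => e2 (coloring_of s))).
rewrite !sumD !sumZ eqz eqzy.
have hx : (\sum_s (zyy (coloring_of s) + Zb (xb (coloring_of s)))%ZZ <= 1 * N)%ZZ.
  apply: sum_le => s; have := no_diamond ((sval (@relabel_coloring_of (1, 2, 3, 0)%N isT)) * s)%g.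
  rewrite -(svalP (@relabel_coloring_of (1, 2, 3, 0)%N isT)) /diamond /zyy /zy.
  by case: (coloring_of s) => /= ? [] ? ? ? ? ? [] [] ? [] ? ? ?.
have hy : (\sum_s (Zb (za (coloring_of s)) - zy (coloring_of s) + Zb (ybu (coloring_of s)))%ZZ <= 1 * N)%ZZ.
  by apply: sum_le => s; rewrite /zy; case: (coloring_of s) => /= ? ? ? ? ? ? ? [] ? ? [].
move: hx hy; rewrite sumD sumD sumB eqz.
have -> : \sum_s Zb (xb (coloring_of s)) = SX.
  exact: (@sum_relabel (fun c => Zb (xa c)) (1, 0, 2, 3)%N).
have -> : \sum_s Zb (ybu (coloring_of s)) = SY.
  exact: (@sum_relabel (fun c => Zb (yab c)) (1, 2, 0, 3)%N).
have -> : Z.of_nat m.-1 = (k - 1)%ZZ by rewrite /k; lia.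
have k1 : (1 <= k)%ZZ by rewrite /k; lia.
move: (\sum_s zyy _) (\sum_s zy _) SX SY SZ N => r w X Y V M h1 h2 h3.
have h4 : (0 <= k * (144 * k * (k - 1) * r - 120 * k * k * w + l * l * V))%ZZ.
  by rewrite /l in h3 *; lia.
have {}h4 : (0 <= 144 * k * (k - 1) * r - 120 * k * k * w + l * l * V)%ZZ.
  by apply/(Z.mul_nonneg_cancel_l k) => //; lia.
have h5 : (0 <= 144 * (k * (k - 1)) * (M - X - r))%ZZ.
  by apply: Z.mul_nonneg_nonneg; [apply: Z.mul_nonneg_nonneg => //; apply: Z.mul_nonneg_nonneg|]; lia.
have h6 : (0 <= 120 * (k * k) * (M - Y - V + w))%ZZ.
  by apply: Z.mul_nonneg_nonneg; [apply: Z.mul_nonneg_nonneg => //; apply: Z.mul_nonneg_nonneg|]; lia.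
by rewrite /l in h4; lia.
Qed.

Let cardU_disjoint (A B : {set T}) : [disjoint A & B] -> #|A :|: B| = (#|A| + #|B|)%N.
Proof. by rewrite cardsU => /disjoint_setI0 ->; rewrite cards0 subn0. Qed.

Let card_RP1 : #|R :|: P1| = (#|R| + #|P1|)%N.
Proof.
by apply: cardU_disjoint; apply: disjointWr disjR; rewrite subsetUl.
Qed.

Lemma card_low : #|low a| = #|R|.+1.
Proof. by rewrite cardsU1 eqs. Qed.

Lemma card_mid : #|mid a b| = (#|R| + #|P1|).+2.
Proof. by rewrite !cardsU1 !inE !eqs card_RP1. Qed.

Lemma card_quadP2 : #|quad :|: P2| = (#|R| + #|P1| + #|P2|).+4.
Proof.
have -> : quad :|: P2 = a |: (b |: (u |: (v |: (R :|: P1 :|: P2)))).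
  by apply/setP=> w; rewrite !inE -!orbA.
by rewrite !cardsU1 !inE !eqs /= -setUA !cardU_disjoint //; lia.
Qed.

Lemma card_top : #|top v| = (#|R| + #|P1| + #|P2|).+3.
Proof.
by have := cardsD1 v (quad :|: P2); rewrite card_quadP2 !inE eqxx !orbT => -[].
Qed.

Lemma card_core : #|core| = #|R|.+2.
Proof. by rewrite /core -setUA !cardsU1 !inE !eqs. Qed.

Lemma card_downs : #|downs| = #|R|.+2.
Proof. by rewrite /downs -setUA !cardsU1 !inE !eqs. Qed.

Lemma card_ups : #|ups| = (#|T| - (#|R| + #|P1| + #|P2| + 2))%N.
Proof.
rewrite /ups -setUA !cardsU1 !inE !eqs !eqxx ?orbT /= cardsCs setCK card_quadP2.
have := subset_leq_card (subsetT (quad :|: P2)); rewrite cardsT card_quadP2.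
by move: #|T| => n; lia.
Qed.
End Frame.

Local Close Scope ring_scope.

(** * From densities to cardinalities *)

Local Open Scope R_scope.

Lemma density_bound (m : nat) (x y z : R) : (2 <= m)%N -> 0 <= z <= x -> x <= 1 ->
    let k := IZR (Z.of_nat m) in
    120 * k * k * (x + y + z) <=
      120 * k * k * (1 + x) + 144 * k * (k - 1) * (1 - x) + (5 * k + 6) * (5 * k + 6) * z ->
    ((24 <= m)%N -> k * (x + y + z) * 2400000 <=
      k * 5162904 + 24 * 96000 * (x + z) - 600000) ->
  (x + y + z) * (k + 2) - 2 * z <= 2.15121 * (k + 2).
Proof.
move=> m2 [z0 zx] x1 k hII hI.
case: (leqP 24 m) => hm.
  have {}hI := hI hm.
  have k24 : 24 <= k.
    by apply: IZR_le; move/leP: hm; lia.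
  pose d := / k.
  have kd : k * d = 1 by apply: Rinv_r; lra.
  have d0 : 0 < d by apply: Rinv_0_lt_compat; lra.
  have d24 : d <= / 24 by apply: Rinv_le_contravar; lra.
  have hI' : x + y + z <= 2.15121 + d * (0.96 * (x + z) - 0.25).
    have : 0 <= d * (k * 5162904 + 24 * 96000 * (x + z) - 600000 - k * (x + y + z) * 2400000).
      by apply: Rmult_le_pos; lra.
    have -> : d * (k * 5162904 + 24 * 96000 * (x + z) - 600000 - k * (x + y + z) * 2400000) =
      (k * d) * 5162904 + d * (24 * 96000 * (x + z) - 600000) - (k * d) * (x + y + z) * 2400000 by ring.
    by rewrite kd; lra.
  have hII' : x + y + z <= 1 + x + 1.2 * (1 - d) * (1 - x) + (5 + 6 * d) * (5 + 6 * d) / 120 * z.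
    have : 0 <= d * d * (120 * k * k * (1 + x) + 144 * k * (k - 1) * (1 - x)
        + (5 * k + 6) * (5 * k + 6) * z - 120 * k * k * (x + y + z)).
      by apply: Rmult_le_pos; [apply: Rmult_le_pos|]; lra.
    have -> : d * d * (120 * k * k * (1 + x) + 144 * k * (k - 1) * (1 - x)
        + (5 * k + 6) * (5 * k + 6) * z - 120 * k * k * (x + y + z)) =
      120 * (k * d) * (k * d) * (1 + x) + 144 * (k * d) * ((k * d) - d) * (1 - x)
        + (5 * (k * d) + 6 * d) * (5 * (k * d) + 6 * d) * z - 120 * (k * d) * (k * d) * (x + y + z) by ring.
    by rewrite kd; lra.
  have gain : (2 - 4 * d) * d * z * (k + 2) <= 2 * z.
    have -> : (2 - 4 * d) * d * z * (k + 2) = z * (2 - 4 * d) * (k * d + 2 * d) by ring.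
    by rewrite kd; nra.
  suff : x + y + z - (2 - 4 * d) * d * z <= 2.15121.
    by move=> h; nra.
  case: (Rle_dec (0.96 * (x + z) - 0.25) ((2 - 4 * d) * z)) => [h|/Rnot_le_lt h].
    by nra.
  have hx : 0 <= (0.2 - 1.2 * d) * (0.96 * (x + z) - 0.25 - (2 - 4 * d) * z).
    by apply: Rmult_le_pos; lra.
  have hz : z <= 1 by lra.
  have dz : d * z <= d by nra.
  have ddz : 0 <= d * d * z by apply: Rmult_le_pos => //; nra.
  have ddz' : d * d * z <= / 24 * (d * z).
    have : 0 <= (/ 24 - d) * (d * z) by apply: Rmult_le_pos; [lra | nra].
    lra.
  by nra.
have : (m < 24)%N by [].
move: m2 hII {hI hm}; rewrite {}/k.
do 2 (case: m => [//|m]).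
do 22 (case: m => [|m]; first by move=> _ /= h _; lra).
by [].
Qed.

Local Close Scope R_scope.

Definition layer (T : finType) (G : {set {set T}}) i := #|[set A in G | #|A| == i]|.

Definition dual (T : finType) (G : {set {set T}}) : {set {set T}} := [set ~: A | A in G].

Section Levels.
Variable T : finType.
Implicit Types (G : {set {set T}}) (A B D : {set T}).

Lemma mem_dual G A : (A \in dual G) = (~: A \in G).
Proof.
apply/imsetP/idP => [[B BG ->]|AG]; first by rewrite setCK.
by exists (~: A); rewrite ?setCK.
Qed.

Lemma dual_diamond_free G : diamond_free G -> diamond_free (dual G).
Proof.
move=> fr A B B' D; rewrite !mem_dual => AG BG BG' DG AB AB' BD BD'.
by apply: setC_inj; apply: (fr (~: D) _ _ (~: A)); rewrite ?properC ?setCK.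
Qed.

Lemma layer_dual G i : i <= #|T| -> layer (dual G) i = layer G (#|T| - i).
Proof.
move=> iT; rewrite /layer -(card_imset _ (@setC_inj T)).
congr #|pred_of_set _|; apply/setP=> A; rewrite inE; apply/imsetP/andP.
  case=> B; rewrite inE mem_dual => /andP[BG /eqP cB] ->; split=> //.
  by rewrite cardsCs setCK cB.
case=> AG /eqP cA; exists (~: A); rewrite ?setCK // inE mem_dual setCK AG /=.
by rewrite cardsCs setCK cA subKn ?eqxx.
Qed.

Lemma layer_le_bin G i : layer G i <= 'C(#|T|, i).
Proof.
rewrite -card_draws; apply: subset_leq_card; apply/subsetP=> A.
by rewrite !inE => /andP[].
Qed.

Lemma exists_frame i j k : 0 < i -> i < j -> j < k -> k < #|T| ->
  exists a b u v : T, exists R P1 P2 : {set T},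
  [/\ uniq [:: a; b; u; v], forall w, w \in [:: a; b; u; v] -> w \notin R :|: P1 :|: P2,
      [disjoint R & P1 :|: P2], [disjoint P1 & P2] &
      [/\ #|R| = i.-1, #|P1| = j - i.+1 & #|P2| = k - j.+1]].
Proof.
move=> i0 ij jk kT; have := enum_uniq T; rewrite cardE in kT; move: kT.
case: (enum T) => [|a [|b [|u [|v e]]]] /= kT; try by exfalso; lia.
rewrite -[_ && _]/(uniq ([:: a; b; u; v] ++ e)) cat_uniq => /and3P[u4 dis ue].
pose e1 := drop i.-1 e; pose e2 := drop (j - i.+1) e1.
exists a, b, u, v, [set x in take i.-1 e], [set x in take (j - i.+1) e1],
  [set x in take (k - j.+1) e2].
have eE : e = take i.-1 e ++ e1 by rewrite cat_take_drop.
have e1E : e1 = take (j - i.+1) e1 ++ e2 by rewrite cat_take_drop.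
have ue1 : uniq e1 by apply: drop_uniq.
have cardS (l : seq T) : uniq l -> #|[set x in l]| = size l.
  by move=> ul; rewrite cardsE; apply/card_uniqP.
have se1 : size e1 = size e - i.-1 by rewrite size_drop.
split=> //.
- move=> w w4; have we : w \notin e by apply: contra dis => we; apply/hasP; exists w.
  rewrite !inE; apply: contra we; rewrite -orbA => /or3P[] /mem_take //.
    by move/mem_drop.
  by move/mem_drop/mem_drop.
- rewrite disjoint_subset; apply/subsetP=> w; rewrite !inE => we.
  move: ue; rewrite eE cat_uniq => /and3P[_ /hasPn h _]; apply/negP=> /orP wP.
  have : w \in e1 by case: wP => /mem_take // /mem_drop.
  by move/h; rewrite /= we.
- rewrite disjoint_subset; apply/subsetP=> w; rewrite !inE => we.
  move: ue1; rewrite e1E cat_uniq => /and3P[_ /hasPn h _]; apply/negP=> /mem_take.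
  by move/h; rewrite /= we.
- rewrite !cardS ?take_uniq ?drop_uniq //.
  by rewrite !size_takel // /e2 /e1 ?size_drop; move: (size e) kT => n kT; lia.
Qed.

End Levels.

Section Densities.
Variables (T : finType) (G : {set {set T}}).
Hypothesis Gfree : diamond_free G.
Local Open Scope R_scope.

Lemma INR_IZR_sum (U : {set T}) :
  IZR (\sum_(s : {perm T}) Zb (s @: U \in G))%RR * INR 'C(#|T|, #|U|) =
  INR #|{perm T}| * INR (layer G #|U|).
Proof.
have -> : (\sum_(s : {perm T}) Zb (s @: U \in G))%RR =
    Z.of_nat (\sum_(s : {perm T}) (s @: U \in G))%N.
  elim/big_rec2: _ => // s x y _ ->; rewrite Nat2Z.inj_add.
  by case: (_ \in G).
by rewrite -INR_IZR_INZ -!mult_INR; congr INR; rewrite card_permT; apply: sum_perm_imset_mem.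
Qed.

Lemma three_layer_densities i j k m :
    (0 < i)%N -> (i < j)%N -> (j < k)%N -> (k < #|T|)%N ->
    (m <= i.+1)%N -> (m <= (#|T| - k).+1)%N -> (2 <= m)%N ->
  exists x y z : R,
  [/\ 0 <= x <= 1, 0 <= y <= 1, 0 <= z <= 1,
      [/\ INR (layer G i) = x * INR 'C(#|T|, i),
          INR (layer G j) = y * INR 'C(#|T|, j) &
          INR (layer G k) = z * INR 'C(#|T|, k)] &
      z <= x -> let r := IZR (Z.of_nat m) in
        (x + y + z) * (r + 2) - 2 * z <= 2.15121 * (r + 2)].
Proof.
move=> i0 ij jk kT mi mk m2.
have [a [b [u [v [R [P1 [P2 [u4 dis dR dP [cR c1 c2]]]]]]]]] := exists_frame i0 ij jk kT.
have cl : #|low R a| = i by rewrite (card_low dis) cR; lia.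
have cm : #|mid R P1 a b| = j by rewrite (card_mid u4 dis dR) cR c1; lia.
have ct : #|top a b u v R P1 P2 v| = k by rewrite (card_top u4 dis dR dP) cR c1 c2; lia.
have cu : (m <= #|ups a b u v R P1 P2|)%N.
  by rewrite (card_ups u4 dis dR dP) cR c1 c2; move: #|T| kT mk => n kT mk; lia.
have cc : (m <= #|core a b R|)%N by rewrite (card_core u4 dis) cR; lia.
have cd : (m <= #|downs u v R|)%N by rewrite (card_downs u4 dis) cR; lia.
have m0 : (0 < m)%N by lia.
have hII := top_link_bound u4 dis dR dP Gfree m0 cd.
have hI h := certificate_bound u4 dis dR dP Gfree h cu cc cd.
pose col := coloring_of G a b u v R P1 P2.
have eX : IZR (\sum_s Zb (xa (col s)))%RR * INR 'C(#|T|, i) = INR #|{perm T}| * INR (layer G i).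
  by rewrite -cl; exact: INR_IZR_sum.
have eY : IZR (\sum_s Zb (yab (col s)))%RR * INR 'C(#|T|, j) = INR #|{perm T}| * INR (layer G j).
  by rewrite -cm; exact: INR_IZR_sum.
have eZ : IZR (\sum_s Zb (zv (col s)))%RR * INR 'C(#|T|, k) = INR #|{perm T}| * INR (layer G k).
  by rewrite -ct; exact: INR_IZR_sum.
move: (\sum_s Zb (xa _))%RR (\sum_s Zb (yab _))%RR (\sum_s Zb (zv _))%RR eX eY eZ hII hI.
move=> X Y V eX eY eZ hII hI.
have N0 : 0 < INR #|{perm T}| by apply/lt_0_INR/ltP; rewrite card_permT fact_gt0.
have NE := INR_IZR_INZ #|{perm T}|.
have C0 l : (l <= #|T|)%N -> 0 < INR 'C(#|T|, l).
  by move=> lT; apply/lt_0_INR/ltP; rewrite bin_gt0.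
have Ci := C0 i (ltnW (ltn_trans ij (ltn_trans jk kT))).
have Cj := C0 j (ltnW (ltn_trans jk kT)); have Ck := C0 k (ltnW kT).
pose d l := INR (layer G l) / INR 'C(#|T|, l).
have dE l : 0 < INR 'C(#|T|, l) -> INR (layer G l) = d l * INR 'C(#|T|, l).
  by move=> Cl; rewrite /d /Rdiv Rmult_assoc Rinv_l ?Rmult_1_r //; lra.
have d01 l : 0 < INR 'C(#|T|, l) -> 0 <= d l <= 1.
  move=> Cl; split; first by apply: Rle_mult_inv_pos => //; apply: pos_INR.
  apply: (Rmult_le_reg_r (INR 'C(#|T|, l))) => //; rewrite -dE // Rmult_1_l.
  by apply/le_INR/leP; apply: layer_le_bin.
have sE (W : Z) l : 0 < INR 'C(#|T|, l) ->
    IZR W * INR 'C(#|T|, l) = INR #|{perm T}| * INR (layer G l) ->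
    IZR W = INR #|{perm T}| * d l.
  move=> Cl; rewrite (dE l Cl) -Rmult_assoc => e.
  by apply: Rmult_eq_reg_r e _; lra.
have {}eX := sE _ _ Ci eX; have {}eY := sE _ _ Cj eY; have {}eZ := sE _ _ Ck eZ.
exists (d i), (d j), (d k); split; try exact: d01; first by split; apply: dE.
move=> zx; apply: density_bound => //; first by case: (d01 k Ck); split.
- by case: (d01 i Ci).
- move/IZR_le: hII; rewrite !(plus_IZR, mult_IZR, minus_IZR) eX eY eZ -NE => hII.
  by apply: (Rmult_le_reg_l _ _ _ N0); cbv zeta; lra.
- move=> h; move/IZR_le: (hI h); rewrite !(plus_IZR, mult_IZR, minus_IZR) eX eY eZ -NE => {}hI.
  by apply: (Rmult_le_reg_l _ _ _ N0); cbv zeta; lra.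
Qed.
End Densities.

Lemma leq_bin_mid n l : 'C(n, l) <= 'C(n, n./2).
Proof.
have up i d : i + d <= n./2 -> 'C(n, i) <= 'C(n, i + d).
  elim: d => [|d IH] id; first by rewrite addn0.
  apply: (leq_trans (IH _)); first by lia.
  have := mul_bin_left n (i + d); rewrite addnS => e.
  rewrite -(leq_pmul2l (ltn0Sn (i + d))) e leq_pmul2r ?bin_gt0; lia.
case: (leqP l n./2) => h; first by rewrite -[n./2](subnKC h) up ?subnKC.
case: (leqP l n) => ln; last by rewrite bin_small.
rewrite -(bin_sub ln); have h' : n - l <= n./2 by lia.
by rewrite -[n./2](subnKC h') up ?subnKC.
Qed.

Lemma bin_ratio n l d : l + d <= n - l -> (l + d) * 'C(n, l) <= l.+1 * 'C(n, n./2).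
Proof.
move=> ld; apply: (@leq_trans ((n - l) * 'C(n, l))); first by rewrite leq_mul2r ld orbT.
by rewrite -mul_bin_left leq_mul2l leq_bin_mid orbT.
Qed.

Section ThreeLayers.
Variable T : finType.
Implicit Types G : {set {set T}}.
Local Notation n := #|T|.

Lemma layers_le_of_density_le G i j k : diamond_free G ->
    0 < i -> i < j -> j < k -> k < n ->
    layer G k * 'C(n, i) <= layer G i * 'C(n, k) ->
  (INR (layer G i + layer G j + layer G k) <= 2.15121 * INR 'C(n, n./2))%R.
Proof.
move=> fr i0 ij jk kn dens; set m := minn i.+1 (n - k).+1.
have mi : m <= i.+1 by apply: geq_minl.
have mk : m <= (n - k).+1 by apply: geq_minr.
have m2 : 2 <= m by rewrite /m; move: n kn => N0 kn; lia.
have [x [y [z [hx hy hz [ei ej ek] H]]]] := three_layer_densities fr i0 ij jk kn mi mk m2.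
have Cp l : l <= n -> (0 < INR 'C(n, l))%R.
  by move=> ln; apply/lt_0_INR/ltP; rewrite bin_gt0.
have Ci := Cp i (ltnW (ltn_trans ij (ltn_trans jk kn))); have Ck := Cp k (ltnW kn).
have zx : (z <= x)%R.
  move/leP/le_INR: dens; rewrite !mult_INR ei ek => dens.
  apply: (Rmult_le_reg_r (INR 'C(n, k) * INR 'C(n, i))%R); first exact: Rmult_lt_0_compat.
  by lra.
have {H} := H zx; set r := IZR _ => /= H.
have rE : r = INR m by rewrite INR_IZR_INZ.
have r0 : (2 <= r)%R by rewrite rE -[2%R]/(INR 2); apply/le_INR/leP.
have M0 : (0 < INR 'C(n, n./2))%R by apply: Cp; rewrite leq_half_double; lia.
have CM l : (INR 'C(n, l) <= INR 'C(n, n./2))%R by apply/le_INR/leP/leq_bin_mid.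
pose e := (INR 'C(n, n./2) / (r + 2))%R.
have eE : (e * (r + 2) = INR 'C(n, n./2))%R by rewrite /e; field; lra.
have e0 : (0 <= e)%R by apply: Rle_mult_inv_pos; lra.
have gain l d : l + d <= n - l -> 0 < d -> m = l.+1 ->
    (INR 'C(n, l) <= INR 'C(n, n./2) - INR d.-1 * INR 'C(n, n./2) / (r + INR d.-1))%R.
  move=> ld d0 ml; have hd : (0 <= INR d.-1)%R by apply: pos_INR.
  apply: (Rmult_le_reg_l (r + INR d.-1)); first by lra.
  have -> : ((r + INR d.-1) * (INR 'C(n, n./2) - INR d.-1 * INR 'C(n, n./2) / (r + INR d.-1)) =
    r * INR 'C(n, n./2))%R by field; lra.
  rewrite rE ml -plus_INR -!mult_INR; apply/le_INR/leP.
  by rewrite plusE !multE addSn -addnS prednK // bin_ratio.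
have gain3 l : l + 3 <= n - l -> m = l.+1 -> (INR 'C(n, l) <= INR 'C(n, n./2) - 2 * e)%R.
  by move=> ld ml; have := gain l 3 ld isT ml; rewrite /e -[INR 3.-1]/2%R; lra.
have weights : (x * INR 'C(n, i) + z * INR 'C(n, k) <=
    (x + z) * INR 'C(n, n./2) - 2 * z * e)%R.
  have CMi := CM i; have CMk := CM k.
  case: (ltngtP (i + k) n) => hik.
  - have ml : m = i.+1 by rewrite /m; move: n kn hik => N0 kn hik; lia.
    have ld : i + 3 <= n - i by move: n kn hik => N0 kn hik; lia.
    have h := gain3 _ ld ml.
    by nra.
  - have ml : m = (n - k).+1 by rewrite /m; move: n kn hik => N0 kn hik; lia.
    have ld : n - k + 3 <= n - (n - k) by move: n kn hik => N0 kn hik; lia.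
    have := gain3 _ ld ml; rewrite bin_sub ?(ltnW kn) // => h.
    by nra.
  - have ml : m = i.+1 by rewrite /m; move: n kn hik => N0 kn hik; lia.
    have ld : i + 2 <= n - i by move: n kn hik => N0 kn hik; lia.
    have h := gain i 2 ld isT ml.
    have Cki : 'C(n, k) = 'C(n, i) by rewrite -(bin_sub (ltnW kn)) -hik addnK.
    have h' : (INR 'C(n, i) <= INR 'C(n, n./2) - e)%R.
      apply: (Rle_trans _ _ _ h); rewrite -[INR 2.-1]/1%R Rmult_1_l /e.
      have : (/ (r + 2) <= / (r + 1))%R by apply: Rinv_le_contravar; lra.
      by rewrite /Rdiv => h1; nra.
    by rewrite Cki; nra.
rewrite !plus_INR ei ej ek.
have CMj : (y * INR 'C(n, j) <= y * INR 'C(n, n./2))%R.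
  by apply: Rmult_le_compat_l => //; lra.
have : (((x + y + z) * (r + 2) - 2 * z) * e <= 2.15121 * (r + 2) * e)%R.
  by apply: Rmult_le_compat_r.
have -> : (((x + y + z) * (r + 2) - 2 * z) * e = (x + y + z) * (e * (r + 2)) - 2 * z * e)%R by ring.
rewrite [(2.15121 * (r + 2) * e)%R]Rmult_assoc (Rmult_comm (r + 2)) eE; move: weights CMj.
by move: (INR 'C(n, n./2)) (INR 'C(n, i)) (INR 'C(n, j)) (INR 'C(n, k)) e {H eE e0 gain gain3} => *; lra.
Qed.

Theorem three_layers_le G i j k : diamond_free G -> 0 < i -> i < j -> j < k -> k < n ->
  (INR (layer G i + layer G j + layer G k) <= 2.15121 * INR 'C(n, n./2))%R.
Proof.
move=> fr i0 ij jk kn.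
case: (leqP (layer G k * 'C(n, i)) (layer G i * 'C(n, k))) => h.
  exact: layers_le_of_density_le.
have jn := ltn_trans jk kn; have in_ := ltn_trans ij jn.
have := @layers_le_of_density_le (dual G) (n - k) (n - j) (n - i) (dual_diamond_free fr).
rewrite !layer_dual ?leq_subr // (subKn (ltnW kn)) (subKn (ltnW jn)) (subKn (ltnW in_)).
rewrite (bin_sub (ltnW kn)) (bin_sub (ltnW in_)) addnAC (addnC (layer G k)) addnAC => hd.
apply: hd; rewrite ?subn_gt0 ?ltn_sub2l ?(ltnW h) //.
by rewrite ltn_subrL i0 (leq_ltn_trans _ kn).
Qed.

Lemma bottom_layer_le G j k : diamond_free G -> 0 < j -> j < k -> k <= n ->
  layer G 0 + layer G j + layer G k <= 2 * 'C(n, n./2).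
Proof.
move=> fr j0 jk kn.
have hj : layer G j <= 'C(n, n./2) := leq_trans (layer_le_bin G j) (leq_bin_mid n j).
have hk : layer G k <= 'C(n, n./2) := leq_trans (layer_le_bin G k) (leq_bin_mid n k).
have h0 : layer G 0 <= 1 by rewrite (leq_trans (layer_le_bin G 0)) ?bin0.
case: (boolP (set0 \in G)) => e0; last first.
  suff -> : layer G 0 = 0 by lia.
  apply/eqP; rewrite cards_eq0; apply/eqP/setP=> A; rewrite !inE cards_eq0.
  by apply/andP=> -[AG /eqP A0]; rewrite A0 (negPf e0) in AG.
have [hl|hl] : layer G j < 'C(n, j) \/ layer G j = 'C(n, j).
  by have := layer_le_bin G j; rewrite leq_eqVlt => /orP[/eqP|]; [right|left].
  by have := leq_bin_mid n j; lia.
have [hl'|hl'] : layer G k < 'C(n, k) \/ layer G k = 'C(n, k).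
  by have := layer_le_bin G k; rewrite leq_eqVlt => /orP[/eqP|]; [right|left].
  by have := leq_bin_mid n k; lia.
have full l : layer G l = 'C(n, l) -> forall A : {set T}, #|A| = l -> A \in G.
  move=> e A cA; have : [set B in G | #|B| == l] = [set B : {set T} | #|B| == l].
    apply/eqP; rewrite eqEcard card_draws -e leqnn andbT.
    by apply/subsetP=> B; rewrite !inE => /andP[].
  by move/setP/(_ A); rewrite !inE cA eqxx andbT.
have sub l (V : {set T}) : l <= #|V| -> exists2 U : {set T}, U \subset V & #|U| = l.
  move=> lV; exists [set x in take l (enum V)].
    by apply/subsetP=> x; rewrite inE => /mem_take; rewrite mem_enum.
  rewrite cardsE (card_uniqP _) ?take_uniq ?enum_uniq // size_takel // -cardE //.
have [|D _ cD] := sub k [set: T]; first by rewrite cardsT.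
have [|B sBD cB] := sub j D; first by rewrite cD ltnW.
have [x xB] : exists x, x \in B by apply/card_gt0P; rewrite cB.
have [y yD yB] : exists2 y, y \in D & y \notin B.
  by apply/subsetPn; apply: contraTN jk => /subset_leq_card; rewrite cD cB -leqNgt.
pose B' := y |: (B :\ x).
have cB' : #|B'| = j.
  rewrite cardsU1 !inE (negPf yB) andbF /=.
  by have := cardsD1 x B; rewrite xB cB.
have sBD' : B' \subset D.
  apply/subsetP=> w; rewrite !inE => /orP[/eqP -> //|/andP[_ wB]].
  exact: (subsetP sBD).
have pr0 (A : {set T}) : #|A| = j -> set0 \proper A.
  by move=> cA; rewrite proper0 -card_gt0 cA.
have prD (A : {set T}) : A \subset D -> #|A| = j -> A \proper D.
  by move=> sA cA; rewrite properEcard sA cA cD.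
have := fr set0 B B' D e0 (full _ hl _ cB) (full _ hl _ cB') (full _ hl' _ cD)
  (pr0 _ cB) (pr0 _ cB') (prD _ sBD cB) (prD _ sBD' cB').
by move/setP/(_ y); rewrite !inE eqxx (negPf yB).
Qed.

Lemma top_layer_le G i j : diamond_free G -> i < j -> j < n ->
  layer G i + layer G j + layer G n <= 2 * 'C(n, n./2).
Proof.
move=> fr ij jn; have in_ := ltn_trans ij jn.
have := @bottom_layer_le (dual G) (n - j) (n - i) (dual_diamond_free fr).
rewrite !layer_dual ?leq_subr // subn0 (subKn (ltnW jn)) (subKn (ltnW in_)).
rewrite addnC addnA addnAC => hd.
by apply: hd; rewrite ?subn_gt0 ?ltn_sub2l ?leq_subr.
Qed.

End ThreeLayers.

Lemma Q2_free_diamond_free n (G : {set {set 'I_n}}) : Q2_free G -> diamond_free G.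
Proof.
move=> fr A B B' D AG BG BG' DG AB AB' BD BD'; apply/eqP/negPn/negP=> nBB.
apply: fr; exists A, B, B', D; split=> //; last 2 first.
- by split; apply: proper_sub.
- by split; apply: proper_sub.
have ne (U V : {set 'I_n}) : U \proper V -> U != V by rewrite properEneq => /andP[].
by rewrite /= !inE !negb_or nBB !ne //; apply: proper_trans AB BD.
Qed.

Lemma card_eq_sum_layers n (G : {set {set 'I_n}}) :
  #|G| = \sum_(i <- set_sizes G) layer G i.
Proof.
rewrite -sum1_card big_mkcond /=.
rewrite (eq_bigr (fun A => \sum_(i <- set_sizes G) ((A \in G) && (#|A| == i) : nat))) => [|A _].
  rewrite exchange_big /=; apply: eq_bigr => i _.
  by rewrite -big_mkcond sum1_card; apply: eq_card => A; rewrite !inE.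
case: (boolP (A \in G)) => AG /=; last by rewrite big1.
rewrite (bigD1_seq #|A|) ?undup_uniq //=; last first.
  by rewrite mem_undup; apply/mapP; exists A; rewrite ?mem_enum.
by rewrite eqxx big1 // => i /negPf; rewrite eq_sym => ->.
Qed.

Theorem theorem3 (n : nat) (G : {set {set 'I_n}})
    (hsizes : size (set_sizes G) <= 3) (hfree : Q2_free G) :
  (INR #|G| <= 2.15121 * INR 'C(n, n./2))%R.
Proof.
have fr := Q2_free_diamond_free hfree.
have M0 : (0 <= INR 'C(n, n./2))%R by apply: pos_INR.
have two (a : nat) : a <= 2 * 'C(n, n./2) -> (INR a <= 2.15121 * INR 'C(n, n./2))%R.
  by move=> /leP/le_INR; rewrite mult_INR -[INR 2]/2%R; lra.
have lay i : layer G i <= 'C(n, n./2).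
  by have := layer_le_bin G i; rewrite card_ord => h; apply: (leq_trans h); apply: leq_bin_mid.
have inG i : i \in set_sizes G -> i <= n.
  rewrite mem_undup => /mapP[A _ ->]; rewrite -[X in _ <= X]card_ord; exact: max_card.
rewrite card_eq_sum_layers.
have := undup_uniq [seq #|A| | A : {set 'I_n} in G]; rewrite -/(set_sizes G).
rewrite -(perm_big _ (permEl (perm_sort leq _))) -(sort_uniq leq).
have : {subset sort leq (set_sizes G) <= set_sizes G} by move=> i; rewrite mem_sort.
have := sort_sorted leq_total (set_sizes G).
move: hsizes; rewrite -(size_sort leq).
case: (sort leq (set_sizes G)) => [|i [|j [|k [|]]]] //= _.
- by move=> *; rewrite big_nil; apply: two.
- by move=> *; rewrite big_seq1; apply: two; have := lay i; lia.
- by move=> *; rewrite !big_cons big_nil; apply: two; have := lay i; have := lay j; lia.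
rewrite !inE !andbT => /andP[ij jk] sub /andP[]; rewrite negb_or => /andP[nij nik] njk.
have {}ij : i < j by rewrite ltn_neqAle nij.
have {}jk : j < k by rewrite ltn_neqAle njk.
have kn : k <= n by apply/inG/sub; rewrite !inE eqxx !orbT.
rewrite !big_cons big_nil addn0 addnA.
have [i0|i0] := posnP i.
  rewrite i0; apply: two; have := bottom_layer_le fr _ jk; rewrite card_ord; apply=> //.
  by rewrite -i0.
have [kn'|kn'] := eqVneq k n.
  rewrite kn'; apply: two; have := top_layer_le fr ij; rewrite card_ord; apply.
  by rewrite -kn'.
have := three_layers_le fr i0 ij jk; rewrite card_ord; apply.
by rewrite ltn_neqAle kn'.
Qed.
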